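(* Let $v\equiv 1\pmod 6$ with $v\ge 19$. Then there exists a $(v,3,2)$-BIBD $(X,\mathcal{A})$ that has a strong nesting $\phi:\mathcal{A}\to Y$, $X\subseteq Y$, with $|Y|=w=(3v+1)/2$, and this is optimal: no strong nesting of a $(v,3,2)$-BIBD uses fewer points.
   Context: A $(v,k,\lambda)$-BIBD is a pair $(X,\mathcal{A})$ where $X$ is a set of $v$ points and $\mathcal{A}$ is a multiset of $k$-subsets of $X$ (blocks) such that every pair of distinct points lies in exactly $\lambda$ blocks. Given a $(v,k,\lambda)$-BIBD $(X,\mathcal{A})$ and a set $Y\supseteq X$ with $|Y|=w$, a map $\phi:\mathcal{A}\to Y$ is a strong nesting if (1) $\phi(A)\notin A$ for every block $A\in\mathcal{A}$, and (2) the multiset of pairs $\{\{x,\phi(A)\}: A\in\mathcal{A},\ x\in A\}$ (one pair for each block $A$, counted with multiplicity in $\mathcal{A}$, and each $x\in A$) consists of distinct pairs. A strong nesting is optimal if $w=|Y|$ is as small as possible. *)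

(* Defs.v *)
From mathcomp Require Import all_boot.
Set Implicit Arguments. Unset Strict Implicit. Unset Printing Implicit Defensive.

(* Points live in a finite type T, which plays the role of Y; the design's
   point set is X : {set T} (so X ⊆ Y = [set: T] automatically).
   The multiset of blocks is a sequence B of subsets of T;
   block i is  nth set0 B i  for i : 'I_(size B). *)

Definition block (T : finType) (B : seq {set T}) (i : 'I_(size B)) : {set T} :=
  nth set0 B i.

Definition is_BIBD (T : finType) (X : {set T}) (B : seq {set T})
    (v k lambda : nat) : Prop :=
  [/\ #|X| = v,
      (forall A, A \in B -> A \subset X /\ #|A| = k) &
      (forall x y, x \in X -> y \in X -> x != y ->
         count (fun A : {set T} => (x \in A) && (y \in A)) B = lambda)].

Definition strong_nesting (T : finType) (B : seq {set T})
    (phi : 'I_(size B) -> T) : Prop :=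
  (forall i, phi i \notin block i) /\
  (forall i j x y, x \in block i -> y \in block j ->
     [set x; phi i] = [set y; phi j] -> i = j /\ x = y).

(* Main.v *)
Require Import Defs.
From mathcomp Require Import all_boot.
From mathcomp Require Import all_algebra zify.

(* Write v = 6t+1.  Lower bound: the pairs {x, phi A} inside X number at most
   v(v-1)/2, and the blocks nested at a point outside X are disjoint, so there
   are at most 2t of them; as there are 2tv blocks, at least 3t+1 points lie
   outside X.

   Construction: take X = Z_v, and 2t base triples of integers, t "inner" and t
   "outer" ones, whose differences cover each d in [1, 3t] exactly twice up to
   sign modulo v.  The translates of all the base triples form a (v,3,2)-BIBD.
   If the inner triples contain exactly one of y, -y for each y in [1, 3t], then
   nesting every inner translate T + x at x uses each pair of X once.  If the
   outer triples partition [1, 3t], then for fixed x the outer blocks T + x and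
   T + x + (3t+1) are pairwise disjoint, so they can be nested at one new point,
   and 3t+1 new points suffice.

   Base triples exist for every t >= 3: for large t they consist of four
   arithmetic families of length about t/2 and of a bounded number of sporadic
   triples, both found by a computer search; the remaining t are treated by
   explicit solutions. *)

Set Implicit Arguments. Unset Strict Implicit. Unset Printing Implicit Defensive.
Import GRing.Theory.

(** * Lower bound by double counting *)

Section LowerBound.
Variables (T : finType) (X : {set T}) (B : seq {set T}) (phi : 'I_(size B) -> T).
Variable v : nat.
Hypothesis bibd : is_BIBD X B v 3 2.
Hypothesis nest : strong_nesting phi.

Let blockP (i : 'I_(size B)) : block i \subset X /\ #|block i| = 3.
Proof. by case: bibd => _ h _; apply: h; rewrite /block mem_nth. Qed.

(** Both sides count, up to a factor 2, the incidences of blocks with ordered pairs of distinct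
    points: a block contains 6 such pairs, and each of the [v * v.-1] pairs lies in 2 blocks. *)
Lemma block_count : size B * 3 = v * v.-1.
Proof.
case: bibd => cX hB h2.
have e1 : \sum_(i < size B) \sum_(x in X) \sum_(y in X :\ x)
    ((x \in block i) && (y \in block i)) = size B * 6.
  rewrite -[RHS](_ : \sum_(i < size B) 6 = _); last by rewrite sum_nat_const card_ord.
  apply: eq_bigr => i _; have [sX c3] := blockP i.
  have -> : 6 = \sum_(x in block i) 2 by rewrite sum_nat_const c3.
  rewrite [RHS]big_mkcond [LHS]big_mkcond; apply: eq_bigr => x _.
  case: (boolP (x \in block i)) => xb /=; last by case: ifP => // _; rewrite big1.
  rewrite (subsetP sX _ xb).
  have -> : 2 = #|block i :\ x| by have := cardsD1 x (block i); rewrite xb c3 => -[].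
  rewrite -sum1_card big_mkcond [RHS]big_mkcond; apply: eq_bigr => y _.
  rewrite !inE; case: (boolP (y \in block i)) => yb; last by rewrite andbF if_same.
  by rewrite (subsetP sX _ yb).
have e2 : \sum_(i < size B) \sum_(x in X) \sum_(y in X :\ x)
    ((x \in block i) && (y \in block i)) = v * (v.-1 * 2).
  rewrite exchange_big -cX -sum_nat_const; apply: eq_bigr => x xX.
  rewrite exchange_big.
  have -> : #|X|.-1 = #|X :\ x| by rewrite (cardsD1 x X) xX.
  rewrite -sum_nat_const; apply: eq_bigr => y; rewrite !inE => /andP[yx yX].
  rewrite -(h2 x y xX yX) 1?eq_sym // -sum1_count [RHS](big_nth set0) big_mkord [RHS]big_mkcond.
  by apply: eq_bigr => i _; rewrite /block; case: ifP.
lia.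
Qed.

Let pairs (P : pred 'I_(size B)) := [set p : 'I_(size B) * T | P p.1 && (p.2 \in block p.1)].

Let card_pairs P : #|pairs P| = #|P| * 3.
Proof.
rewrite -sum1_card (eq_bigl (fun p => P p.1 && (p.2 \in block p.1))); last by move=> p; rewrite inE.
rewrite -(pair_big_dep P (fun i x => x \in block i) (fun _ _ => 1)) /=.
by rewrite -sum_nat_const; apply: eq_bigr => i _; rewrite sum1_card; case: (blockP i).
Qed.

(** The nesting makes the pairs [[set x; phi i]] distinct over all incidences, and for [phi i] in
    [X] they are 2-subsets of [X]. *)
Lemma inner_count : #|[pred i | phi i \in X]| * 3 <= 'C(v, 2).
Proof.
case: nest => h1 h2; case: bibd => cX _ _.
rewrite -card_pairs -cX -cards_draws.
rewrite -(card_in_imset (f := fun p => [set p.2; phi p.1])); last first.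
  move=> [i x] [j y]; rewrite !inE /= => /andP[_ xi] /andP[_ yj] e.
  by have [-> ->] := h2 _ _ _ _ xi yj e.
apply/subset_leq_card/subsetP => A /imsetP[[i x]]; rewrite !inE /= => /andP[iX xi] ->{A}.
have [sX _] := blockP i; rewrite subUset !sub1set (subsetP sX _ xi) iX /= cards2.
by case: (x =P phi i) => [e|//]; move: (h1 i); rewrite -e xi.
Qed.

(** Blocks nested at the same [y] are disjoint, because a common point [x] would repeat the pair
    [[set x; y]]. *)
Lemma outer_count y : #|[pred i | phi i == y]| * 3 <= v.
Proof.
case: nest => h1 h2; case: bibd => cX _ _.
rewrite -card_pairs -cX.
rewrite -(card_in_imset (f := fun p : 'I_(size B) * T => p.2)); last first.
  move=> [i x] [j z]; rewrite !inE /= => /andP[/eqP iy xi] /andP[/eqP jy zj] e; subst z.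
  by have [->] := h2 _ _ _ _ xi zj (congr1 (fun u => [set x; u]) (etrans iy (esym jy))).
apply/subset_leq_card/subsetP => z /imsetP[[i x]]; rewrite !inE /= => /andP[_ xi] ->{z}.
by have [sX _] := blockP i; apply: subsetP xi.
Qed.

Lemma nesting_lower_bound : v %% 6 = 1 -> 1 < v -> (3 * v + 1) %/ 2 <= #|T|.
Proof.
move=> v1 v_gt1; case: (bibd) => cX _ _.
pose t := v %/ 6.
have hn : #|[pred i | phi i \in X]| + \sum_(y in ~: X) #|[pred i | phi i == y]| = size B.
  have := cardID [pred i | phi i \in X] 'I_(size B); rewrite card_ord => e.
  rewrite -[X in _ = X]e {e}; congr addn.
  rewrite -[RHS]sum1_card (partition_big phi (fun y => y \in ~: X)) /=; last first.
    by move=> i; rewrite !inE andbT.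
  apply: eq_bigr => y; rewrite inE => yX; rewrite -sum1_card; apply: eq_bigl => i.
  by rewrite !inE; case: eqP => [->|]; rewrite ?yX ?andbF.
have ho : \sum_(y in ~: X) #|[pred i | phi i == y]| <= #|~: X| * (2 * t).
  rewrite -sum_nat_const; apply: leq_sum => y _; have := outer_count y; rewrite /t; lia.
have := block_count; have := inner_count; have := cardsC X; rewrite cX bin2.
move: hn ho; set I := #|[pred i | _]|; set S := \sum_(_ in _) _; set w := #|~: X| => hn ho cT hI hb.
have e : v = 6 * t + 1 by rewrite /t; lia.
have t0 : 0 < t by lia.
rewrite -cT; move: hI; rewrite e -[in _./2]divn2 => hI.
have h3 : (6 * t + 1) * (6 * t + 1).-1 %/ 2 = (6 * t + 1) * (3 * t) by nia.
rewrite h3 in hI; rewrite e in hb.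
have h4 : I <= (6 * t + 1) * t by nia.
have h5 : size B = (6 * t + 1) * (2 * t) by nia.
have h6 : (6 * t + 1) * t <= w * (2 * t) by nia.
(* As [6 * t + 1] is odd, this rounds up to [3 * t + 1 <= w]. *)
have h7 : 6 * t + 1 <= 2 * w by nia.
lia.
Qed.

End LowerBound.

(** * From indexed blocks to a sequence of blocks *)

(** Lets the construction use convenient types for points and blocks. It is enough to prove [i = j]
    for coinciding pairs: then [x = y], since otherwise [x] would be the point at which its own
    block is nested. *)
Lemma indexed_nesting (T S J : finType) (f : S -> T) (X : {set S})
    (blk : J -> {set S}) (psi : J -> S) (v k lambda : nat) :
  injective f -> #|X| = v ->
  (forall j, blk j \subset X /\ #|blk j| = k) ->
  (forall x y, x \in X -> y \in X -> x != y ->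
     \sum_j ((x \in blk j) && (y \in blk j)) = lambda) ->
  (forall j, psi j \notin blk j) ->
  (forall i j x y, x \in blk i -> y \in blk j ->
     [set x; psi i] = [set y; psi j] -> i = j) ->
  exists (Y : {set T}) (B : seq {set T}) (phi : 'I_(size B) -> T),
    is_BIBD Y B v k lambda /\ strong_nesting phi.
Proof.
move=> fI cX blkP pairP psiN psiI.
pose B := [seq f @: blk j | j <- enum J].
have sB : size B = #|J| by rewrite size_map -cardE.
pose jj (i : 'I_(size B)) := enum_val (cast_ord sB i).
have blkE i : block i = f @: blk (jj i).
  have j0 := jj i.
  rewrite /block (nth_map j0) ?sB -?cardE; last by rewrite cardE -(size_map (fun j => f @: blk j)).
  by congr (f @: blk _); rewrite /jj (enum_val_nth j0).
exists (f @: X), B, (fun i => f (psi (jj i))); split; split.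
- by rewrite card_imset.
- move=> _ /mapP[j _ ->]; have [sX ck] := blkP j.
  by rewrite imsetS // card_imset.
- move=> _ _ /imsetP[x xX ->] /imsetP[y yX ->]; rewrite (inj_eq fI) => xy.
  rewrite -(pairP x y xX yX xy) count_map -sum1_count big_mkcond /= -big_enum /=.
  by apply: eq_bigr => j _; rewrite !mem_imset //; case: ifP.
- by move=> i; rewrite blkE mem_imset.
move=> i j _ _ /[!blkE] /imsetP[x xi ->] /imsetP[y yj ->].
have img (p q : S) : [set f p; f q] = f @: [set p; q] by rewrite imsetU1 imset_set1.
rewrite !img => /(imset_inj fI) e.
have ij : i = j by apply: (cast_ord_inj (eq_n := sB)); apply: enum_val_inj; apply: psiI e.
split=> //; subst j; congr f.
have : x \in [set y; psi (jj i)] by rewrite -e set21.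
by rewrite !inE => /orP[/eqP //|/eqP ex]; move: (psiN (jj i)); rewrite -ex xi.
Qed.

(** * Base triples of integers *)

Definition triple := (int * int * int)%type.
Definition pts (T : triple) : seq int := [:: T.1.1; T.1.2; T.2].
Definition diffs (T : triple) : seq int :=
  [:: (T.1.1 - T.1.2)%R; (T.1.1 - T.2)%R; (T.1.2 - T.2)%R].

(* For |x| <= v, the representative of x or -x modulo v in [0, v/2]; truncated
   subtraction makes it 0 when |x| >= v, so that 0 < fold v x implies |x| < v. *)
Definition fold (v : nat) (x : int) : nat := minn `|x| (v - `|x|).

(** The outer points are compared as integers, because the disjointness of outer blocks depends on
    these representatives; inner points and differences matter only modulo [v] and up to sign. The
    doubled [iota] encodes lambda = 2. *)
Definition twofold_family (t : nat) (O I : seq triple) : bool :=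
  [&& perm_eq (flatten (map pts O)) (map Posz (iota 1 (3 * t))),
      perm_eq (map (fold (6 * t + 1)) (flatten (map pts I))) (iota 1 (3 * t)) &
      perm_eq (map (fold (6 * t + 1)) (flatten (map diffs (O ++ I))))
              (iota 1 (3 * t) ++ iota 1 (3 * t))].

Lemma uniq_flatten_nth (T : eqType) (ss : seq (seq T)) i j x :
  uniq (flatten ss) -> x \in nth [::] ss i -> x \in nth [::] ss j -> i = j.
Proof.
elim: ss i j => [|s ss IH] [|i] [|j] //=; rewrite cat_uniq => /and3P[_ /hasPn h u] xi xj.
- have jl : j < size ss by case: ltnP xj => // h'; rewrite nth_default.
  have /h : x \in flatten ss by apply/flattenP; exists (nth [::] ss j) => //; apply: mem_nth.
  by rewrite xi.
- have il : i < size ss by case: ltnP xi => // h'; rewrite nth_default.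
  have /h : x \in flatten ss by apply/flattenP; exists (nth [::] ss i) => //; apply: mem_nth.
  by rewrite xj.
by rewrite (IH i j u xi xj).
Qed.

Lemma set2_eq (T : finType) (a b c d : T) :
  [set a; b] = [set c; d] -> (a = c /\ b = d) \/ (a = d /\ b = c).
Proof.
move=> e; have ha : a \in [set c; d] by rewrite -e set21.
have hb : b \in [set c; d] by rewrite -e set22.
have hc : c \in [set a; b] by rewrite e set21.
have hd' : d \in [set a; b] by rewrite e set22.
move: ha hb hc hd'; rewrite !inE.
by move=> /orP[]/eqP h1 /orP[]/eqP h2 /orP[]/eqP h3 /orP[]/eqP h4; subst; auto.
Qed.

Local Notation z0 := (0%R, 0%R, 0%R).

(** * Residues modulo [v] and translates of base triples *)

Section Residues.
Variable t : nat.
Hypothesis t_gt0 : 0 < t.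
Let v := 6 * t + 1.
Let v_gt1 : 1 < v. Proof. rewrite /v; lia. Qed.
Local Notation G := 'Z_v.
Local Notation "x %:G" := (x%:~R : G)%R (at level 2).
Local Open Scope ring_scope.

Lemma card_G : #|{: G}| = v. Proof. by rewrite card_ord Zp_cast. Qed.

Lemma intG_eq0 (x : int) : (x%:G == 0) = (v %| `|x|)%N.
Proof.
have -> : (x%:G == 0) = ((`|x|%N : nat)%:R == 0 :> G).
  by case: (x) => n //=; rewrite NegzE rmorphN /= oppr_eq0.
by rewrite -val_eqE /= val_Zp_nat.
Qed.

Lemma intG_eq (x y : int) : (x%:G == y%:G) = (v %| `|(x - y)%R|)%N.
Proof. by rewrite -subr_eq0 -rmorphB /= intG_eq0. Qed.

Lemma intG_eqN (x y : int) : (x%:G == - y%:G) = (v %| `|(x + y)%R|)%N.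
Proof. by rewrite -addr_eq0 -rmorphD /= intG_eq0. Qed.

Lemma dvd_small (n : nat) : (n < 2 * v)%N -> (v %| n)%N = (n == 0%N) || (n == v).
Proof.
move=> h; apply/idP/idP => [/dvdnP[[|[|k]] e]|/orP[]/eqP->]; rewrite ?dvdn0 ?dvdnn //; lia.
Qed.

(** A positive fold forces absolute values below [v], so the sum and the difference of [x] and [y]
    stay below [2 * v] in absolute value, where 0 and [v] are the only multiples of [v]. *)
Lemma fold_eq (x y : int) : (0 < fold v x)%N -> (0 < fold v y)%N ->
  (fold v x == fold v y) = (x%:G == y%:G) || (x%:G == - y%:G).
Proof.
rewrite /fold intG_eq intG_eqN => hx hy; rewrite !dvd_small; lia.
Qed.

Lemma fold_neq0 (x : int) : (0 < fold v x)%N -> x%:G != 0.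
Proof. by rewrite intG_eq0 /fold => hx; rewrite dvd_small; lia. Qed.

(** This holds because [v] is odd. *)
Lemma doubleG_eq0 (x : G) : (x == - x) = (x == 0).
Proof.
rewrite -addr_eq0 -(natr_Zp x) -natrD -[RHS]val_eqE -[LHS]val_eqE /= !val_Zp_nat //.
have : (nat_of_ord x < v)%N by have := ltn_ord x; rewrite [X in (_ < X)%N]Zp_cast.
by rewrite -!/(dvdn _ _) => h; rewrite !dvd_small; lia.
Qed.

Definition translate (T : triple) (x : G) : {set G} := [set y | y - x \in [seq a%:G | a <- pts T]].

Lemma posG (x : G) : (Posz (nat_of_ord x))%:G = x.
Proof. by rewrite -pmulrn natr_Zp. Qed.

Lemma translateP T x y : y \in translate T x -> exists2 a, a \in pts T & y = a%:G + x.
Proof. by rewrite inE => /mapP[a ha e]; exists a => //; rewrite -e subrK. Qed.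

Lemma ltn_G (x : G) : (nat_of_ord x < v)%N.
Proof. by have := ltn_ord x; rewrite [X in (_ < X)%N]Zp_cast. Qed.

Lemma uniq_triple T : all (fun d => (0 < fold v d)%N) (diffs T) -> uniq [seq a%:G | a <- pts T].
Proof.
case: T => [[a b] c] /=; rewrite andbT => /and3P[h1 h2 h3]; rewrite !inE !negb_or andbT.
by rewrite -!(subr_eq0 _%:G) -!rmorphB /= !fold_neq0.
Qed.

Lemma card_translate T x : all (fun d => (0 < fold v d)%N) (diffs T) -> #|translate T x| = 3.
Proof.
move=> /uniq_triple u; rewrite -[RHS]/(size [seq a%:G | a <- pts T]) -(card_uniqP u).
rewrite -(card_imset _ (addrI (- x))); apply: eq_card => y.
apply/imsetP/idP => [[z]|h]; first by rewrite inE addrC => h ->.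
exists (y + x); first by rewrite inE addrK.
by rewrite addrCA addNr addr0.
Qed.

(** After the substitution of [u - x] for [x], the sum counts the ordered pairs of base points with
    difference [d]. An unordered pair contributes at most once because [d] and [-d] are distinct
    modulo [v]. *)
Lemma translate_pair_count T (u w : G) (d : int) :
  all (fun d => (0 < fold v d)%N) (diffs T) -> (0 < fold v d)%N -> u - w = d%:G ->
  (\sum_(x : G) ((u \in translate T x) && (w \in translate T x)))%N
  = count (pred1 (fold v d)) [seq fold v e | e <- diffs T].
Proof.
move=> hT hd uw; have uT := uniq_triple hT.
have -> : (\sum_(x : G) ((u \in translate T x) && (w \in translate T x)) =
   \sum_(x <- [seq a%:G | a <- pts T]) ((x - d%:G)%R \in [seq a%:G | a <- pts T]))%N.
  rewrite (big_uniq _ uT) /= [RHS]big_mkcond (reindex_inj (subrI u)) /=.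
    apply: eq_bigr => x _; rewrite !inE subKr -uw.
  have -> : w - (u - x) = x - (u - w) by rewrite !opprB addrCA.
  by case: [|| _, _ | _].
case: T hT uT => [[a b] c]; rewrite /=.
rewrite !andbT !inE !negb_or => /and3P[h1 h2 h3] /andP[/andP[ab ac] bc].
rewrite !big_cons big_nil !inE !fold_eq // !rmorphB /=.
set A := a%:G; set B := b%:G; set C := c%:G; set D := d%:G.
have D0 : D != 0 by apply: fold_neq0.
have DN x : (x == D) && (x == - D) = false.
  by apply: contraNF D0 => /andP[/eqP-> ]; rewrite doubleG_eq0.
have selfF x : (x - D == x) = false.
  by rewrite -[RHS](negbTE D0) -subr_eq0 addrAC subrr sub0r oppr_eq0.
have E x y : (x - D == y) = (x - y == D) by rewrite subr_eq addrC -subr_eq.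
have EN x y : (y - D == x) = (x - y == - D) by rewrite E -opprB eqr_oppLR.
have ex x y z : y != z -> (x - D == y) && (x - D == z) = false.
  by move=> yz; apply: contraNF yz => /andP[/eqP <- /eqP <-].
rewrite !selfF /= !orbF -!E -!EN.
have := (DN (A - B), DN (A - C), DN (B - C)); rewrite -!E -!EN.
have := (ex A _ _ bc, ex B _ _ ac, ex C _ _ ab).
(* One equality is left for each ordered pair of base points. [ex] turns the disjunctions on the
   left into sums, and [DN] does so on the right. *)
by do 6!case: (_ == _) => //=; case=> [[]] //= ? ? ? [[]].
Qed.

Variables O I : seq triple.
Hypothesis fam : twofold_family t O I.

Let O_pts : perm_eq (flatten (map pts O)) (map Posz (iota 1 (3 * t))).
Proof. by case/and3P: fam. Qed.
Let I_pts : perm_eq (map (fold v) (flatten (map pts I))) (iota 1 (3 * t)).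
Proof. by case/and3P: fam. Qed.
Let OI_diffs : perm_eq (map (fold v) (flatten (map diffs (O ++ I))))
                       (iota 1 (3 * t) ++ iota 1 (3 * t)).
Proof. by case/and3P: fam. Qed.

Lemma diffs_pos T : T \in O ++ I -> all (fun d => (0 < fold v d)%N) (diffs T).
Proof.
move=> hT; apply/allP => d hd.
have : fold v d \in map (fold v) (flatten (map diffs (O ++ I))).
  by apply: map_f; apply/flattenP; exists (diffs T) => //; apply: map_f.
by rewrite (perm_mem OI_diffs) mem_cat orbb mem_iota => /andP[].
Qed.

Lemma outer_range i a : a \in pts (nth z0 O i) -> (i < size O)%N ->
  exists2 n, a = Posz n & (0 < n <= 3 * t)%N.
Proof.
move=> ha hi; have : a \in map Posz (iota 1 (3 * t)).
  rewrite -(perm_mem O_pts); apply/flattenP; exists (pts (nth z0 O i)) => //.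
  by apply: map_f; apply: mem_nth.
by case/mapP => n; rewrite mem_iota => /andP[h1 h2] ->; exists n => //; lia.
Qed.

Lemma outer_inj i j a : (i < size O)%N -> (j < size O)%N ->
  a \in pts (nth z0 O i) -> a \in pts (nth z0 O j) -> i = j.
Proof.
move=> hi hj; rewrite -!(nth_map z0 [::] pts) //; apply: uniq_flatten_nth.
by rewrite (perm_uniq O_pts) map_inj_uniq ?iota_uniq // => ? ? [].
Qed.

Lemma inner_pos i a : a \in pts (nth z0 I i) -> (i < size I)%N -> (0 < fold v a)%N.
Proof.
move=> ha hi; have : fold v a \in map (fold v) (flatten (map pts I)).
  apply: map_f; apply/flattenP; exists (pts (nth z0 I i)) => //.
  by apply: map_f; apply: mem_nth.
by rewrite (perm_mem I_pts) mem_iota => /andP[].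
Qed.

Lemma inner_inj i j a b : (i < size I)%N -> (j < size I)%N ->
  a \in pts (nth z0 I i) -> b \in pts (nth z0 I j) ->
  fold v a = fold v b -> i = j /\ a = b.
Proof.
move=> hi hj ha hb ab.
have u : uniq (map (fold v) (flatten (map pts I))) by rewrite (perm_uniq I_pts) iota_uniq.
have memF k c : (k < size I)%N -> c \in pts (nth z0 I k) -> c \in flatten (map pts I).
  move=> hk hc; apply/flattenP; exists (pts (nth z0 I k)) => //.
  by apply: map_f; apply: mem_nth.
have e : a = b.
  have [ma mb] := (memF i a hi ha, memF j b hj hb).
  move/(uniqP 0%N): u => /(_ (index a (flatten (map pts I))) (index b (flatten (map pts I)))).
  rewrite !inE size_map !index_mem => /(_ ma mb).
  rewrite !(nth_map 0) ?index_mem // !nth_index // => /(_ ab) eab.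
  by rewrite -(nth_index 0 ma) eab nth_index.
split=> //; subst b; move: ha hb.
rewrite -!(nth_map z0 [::] pts) //; apply: uniq_flatten_nth.
exact: map_uniq u.
Qed.

(** * The nested design *)

(** [inl] injects the residues, and [inr] the [3 * t + 1] new points. *)
Let S := (G + 'I_(3 * t).+1)%type.
Let J := ('I_(size O) * G + 'I_(size I) * G)%type.

Let blk (j : J) : {set S} := inl @: match j with
  | inl (i, x) => translate (nth z0 O i) x
  | inr (i, x) => translate (nth z0 I i) x end.

(* The translates by x and x + (3t+1) of the outer blocks are disjoint, since
   their base points lie in [1, 3t]; they share one point at infinity. *)
Let psi (j : J) : S := match j with
  | inl (i, x) => inr (inord (x %% (3 * t).+1))
  | inr (i, x) => inl x end.

Let blkT (j : J) : exists2 T, T \in O ++ I & exists x, blk j = inl @: translate T x.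
Proof.
case: j => -[i x] /=; [exists (nth z0 O i) | exists (nth z0 I i)].
- by rewrite mem_cat mem_nth.
- by exists x.
- by rewrite mem_cat mem_nth ?orbT.
by exists x.
Qed.

Let sum_nth (L : seq triple) (F : triple -> nat) :
  (\sum_(i < size L) F (nth z0 L i) = \sum_(T <- L) F T)%N.
Proof. by rewrite (big_nth z0) big_mkord. Qed.

(** Summed over all base triples, the pair counts give the multiplicity of the folded difference of
    [u] and [w] in the list of all differences, which is 2 by [OI_diffs]. *)
Lemma blk_pair_count (u w : G) : u != w ->
  (\sum_(j : J) ((inl u \in blk j) && (inl w \in blk j)) = 2)%N.
Proof.
move=> uw; rewrite -subr_eq0 in uw.
pose d : int := Posz (nat_of_ord (u - w)).
have dE : u - w = d%:G by rewrite posG.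
have hd : (0 < fold v d <= 3 * t)%N.
  have h1 := ltn_G (u - w).
  have h2 : (0 < nat_of_ord (u - w)%R)%N by rewrite lt0n.
  by rewrite /fold /d; move: (nat_of_ord _) h1 h2 => n h1 h2; lia.
have hd0 : (0 < fold v d)%N by case/andP: hd.
pose tr (L : seq triple) (i : nat) (x : G) := translate (nth z0 L i) x.
have key (L : seq triple) : {subset L <= O ++ I} ->
    (\sum_(p : 'I_(size L) * G) ((u \in tr L p.1 p.2) && (w \in tr L p.1 p.2)) =
      count (pred1 (fold v d)) (map (fold v) (flatten (map diffs L))))%N.
  move=> sL; pose F (i : 'I_(size L)) (x : G) : nat := (u \in tr L i x) && (w \in tr L i x).
  rewrite -(pair_bigA _ F) /= map_flatten count_flatten -!map_comp sumnE big_map -sum_nth.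
  apply: eq_bigr => i _; apply: translate_pair_count => //.
  by apply/diffs_pos/sL/mem_nth.
have inlE (A : {set G}) z : (inl z \in (inl @: A : {set S})) = (z \in A).
  by rewrite mem_imset // => ? ? [].
have -> : (\sum_(j : J) ((inl u \in blk j) && (inl w \in blk j)) =
    \sum_(p : 'I_(size O) * G) ((u \in tr O p.1 p.2) && (w \in tr O p.1 p.2))
  + \sum_(p : 'I_(size I) * G) ((u \in tr I p.1 p.2) && (w \in tr I p.1 p.2)))%N.
  by rewrite big_sumType; congr addn; apply: eq_bigr => -[i x] _; rewrite !inlE.
rewrite !key; try by move=> T hT; rewrite mem_cat hT ?orbT.
rewrite -count_cat -map_cat -flatten_cat -map_cat (permP OI_diffs) count_cat.
by rewrite count_uniq_mem ?iota_uniq // mem_iota; case/andP: hd => -> /=; rewrite add1n ltnS => ->.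
Qed.

(** An outer block has no point at infinity; an inner block [T + x] would contain [x] only if 0 were
    a base point. *)
Lemma psi_notin_blk j : psi j \notin blk j.
Proof.
case: j => -[i x]; apply/imsetP => -[y] //=; rewrite inE => /mapP[a ha e] [xy].
by move: (fold_neq0 (inner_pos ha (ltn_ord i))); rewrite -e xy subrr eqxx.
Qed.

Lemma blk_psi_inj (i j : J) x y : x \in blk i -> y \in blk j ->
  [set x; psi i] = [set y; psi j] -> i = j.
Proof.
case: i j => -[i p] [] [j q]
  /imsetP[x' /translateP[a ha ->] ->] /imsetP[y' /translateP[b hb ->] ->]
  /set2_eq [] [] //=.
(* Two outer blocks. If [p] and [q] differed, it would be by [3 * t + 1], so [a - b] would be
   congruent to [3 * t] or [- (3 * t)] modulo [v]; but its absolute value is at most [3 * t - 1]. *)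
- move=> e1 e2; have xy := inl_inj e1.
  have := congr1 (@nat_of_ord _) (inr_inj e2); rewrite !inordK ?ltn_mod // => pq.
  have [m am /andP[m0 mt]] := outer_range ha (ltn_ord i).
  have [n bn /andP[n0 nt]] := outer_range hb (ltn_ord j).
  have := ltn_G p; have := ltn_G q.
  have : (a + Posz (nat_of_ord p))%:G == (b + Posz (nat_of_ord q))%:G.
    by rewrite !rmorphD /= !posG xy.
  have [k1 k2] : ((nat_of_ord p < 2 * (3 * t).+1) /\ (nat_of_ord q < 2 * (3 * t).+1))%N.
    by split; [have := ltn_G p|have := ltn_G q]; rewrite /v; lia.
  rewrite intG_eq am bn.
  have mod2 P : (P < 2 * (3 * t).+1)%N ->
      (P %% (3 * t).+1 = P \/ P %% (3 * t).+1 + (3 * t).+1 = P)%N.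
    move=> hP; case: (ltnP P (3 * t).+1) => h; first by left; rewrite modn_small.
    by right; rewrite -{1}(subnK h) modnDr modn_small; lia.
  have := mod2 _ k1; have := mod2 _ k2; rewrite pq => cq cp ea ltq ltp.
  have [mn pq'] : m = n /\ (nat_of_ord p = nat_of_ord q)%N.
    move: ea cq cp ltq ltp; rewrite /v; move: (nat_of_ord p) (nat_of_ord q) (_ %% _)%N => P Q r.
    by move=> ea cq cp ltq ltp; rewrite dvd_small in ea; lia.
  have ij : i = j.
    by apply/val_inj/(outer_inj (ltn_ord i) (ltn_ord j) ha); rewrite am mn -bn.
  by subst j; congr (inl (_, _)); apply: val_inj.
- move=> e1 e2; have xy := inl_inj e1; have pq := inl_inj e2.
  have ab : a%:G == b%:G by rewrite -(inj_eq (addIr p)) {2}pq xy.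
  have /eqP fab : fold v a == fold v b by rewrite fold_eq ?ab ?(inner_pos ha) ?(inner_pos hb).
  have [ij _] := inner_inj (ltn_ord i) (ltn_ord j) ha hb fab.
  by subst q; congr (inr (_, _)); apply: val_inj.
(* Two inner blocks whose pairs agree crosswise: then [a = - b] modulo [v], so the folds agree,
   [a = b], and [a] vanishes modulo [v], which its positive fold excludes. *)
move=> e1 e2; have xq := inl_inj e1; have px := inl_inj e2.
have ab : a%:G == - b%:G by rewrite -addr_eq0 -(inj_eq (addIr p)) add0r {2}px addrAC xq addrC.
have a0 := inner_pos ha (ltn_ord i); have b0 := inner_pos hb (ltn_ord j).
have /eqP fab : fold v a == fold v b by rewrite fold_eq // ab orbT.
have [_ e] := inner_inj (ltn_ord i) (ltn_ord j) ha hb fab.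
by move: ab (fold_neq0 a0); rewrite -e doubleG_eq0 => ->.
Qed.

Lemma card_S : #|{: S}| = (9 * t + 2)%N.
Proof. by rewrite card_sum card_G card_ord /v; lia. Qed.

Lemma nested_design (w : nat) : w = (9 * t + 2)%N ->
  exists (X : {set 'I_w}) (B : seq {set 'I_w}) (phi : 'I_(size B) -> 'I_w),
    is_BIBD X B v 3 2 /\ strong_nesting phi.
Proof.
move=> ->; rewrite -card_S.
apply: (@indexed_nesting _ S J enum_rank (inl @: [set: G]) blk psi).
- exact: enum_rank_inj.
- by rewrite card_imset ?cardsT ?card_G // => ? ? [].
- move=> j; have [T hT [x ->]] := blkT j; split; first by rewrite imsetS // subsetT.
  by rewrite card_imset ?card_translate ?diffs_pos // => ? ? [].
- move=> _ _ /imsetP[u _ ->] /imsetP[w' _ ->] uw; apply: blk_pair_count.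
  by apply: contraNneq uw => ->.
- exact: psi_notin_blk.
exact: blk_psi_inj.
Qed.

End Residues.

(** * Parametric lists of base triples *)

(* A row (T0, D, n, cs) stands for the triples T0 + i D, i < n; the three
   differences of such a triple get the colours cs.  The differences of each
   colour will cover [1, 3t] exactly once, so that each of the two covers can be
   checked by surjectivity and counting. *)
Definition row := (triple * triple * nat * seq bool)%type.

Definition lin (m : nat) (c : int * int) : int := (c.1 * m%:Z + c.2)%R.

Definition run m (p q r : int * int) (a b c : int) (n : nat) (cs : seq bool) : row :=
  (lin m p, lin m q, lin m r, (a, b, c), n, cs).

Definition single m p q r cs : row := run m p q r 0 0 0 1 cs.

Definition row0 : row := (0%R, 0%R, 0%R, (0%R, 0%R, 0%R), 0, [::]).

Definition term (r : row) (i : nat) : triple * seq bool :=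
  let: (p, q, s, (a, b, c), _, cs) := r in
  ((p + a * i%:Z, q + b * i%:Z, s + c * i%:Z)%R, cs).

Definition terms (rs : seq row) : seq (triple * seq bool) :=
  flatten [seq [seq term r i | i <- iota 0 r.1.2] | r <- rs].

Definition triples (rs : seq row) : seq triple := map fst (terms rs).

Definition coloured_diffs (v : nat) (rs : seq row) : seq (nat * bool) :=
  flatten [seq zip (map (fold v) (diffs T.1)) T.2 | T <- terms rs].

(** For [0 < x <= v / 2] these four values are exactly the integers that [fold] sends to [x]. *)
Definition branch (v x b : nat) : int :=
  match b with 0 => x | 1 => - x%:Z | 2 => v%:Z - x%:Z | _ => x%:Z - v%:Z end%R.

Lemma fold_branch v x b : x * 2 <= v -> fold v (branch v x b) = x.
Proof. by case: b => [|[|[|b]]] /= h; rewrite /fold; lia. Qed.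

Definition hit (g : triple -> seq int) (rs : seq row) (k j i : nat) (z : int) : bool :=
  let r := nth row0 rs k in
  [&& k < size rs, i < r.1.2, j < 3 & nth 0%R (g (term r i).1) j == z].

Lemma term_mem rs k i : k < size rs -> i < (nth row0 rs k).1.2 ->
  term (nth row0 rs k) i \in terms rs.
Proof.
move=> hk hi; apply/flattenP; exists [seq term (nth row0 rs k) i | i <- iota 0 (nth row0 rs k).1.2].
  by apply: (map_f (fun r : row => [seq term r i | i <- iota 0 r.1.2])); apply: mem_nth.
by apply: map_f; rewrite mem_iota.
Qed.

Lemma pts_hit rs k j i z : hit pts rs k j i z -> z \in flatten (map pts (triples rs)).
Proof.
case/and4P => hk hi hj /eqP <-; apply/flattenP.
exists (pts (term (nth row0 rs k) i).1); last exact: mem_nth.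
by apply: map_f; apply: map_f; apply: term_mem.
Qed.

Lemma pts_cover rs x (opts : seq (nat * nat * nat * nat)) :
  has (fun o => let: (k, j, i, b) := o in hit pts rs k j i (Posz x)) opts ->
  Posz x \in flatten (map pts (triples rs)).
Proof. by case/hasP => -[[[k j] i] b] _; apply: pts_hit. Qed.

Lemma fold_cover v rs x (opts : seq (nat * nat * nat * nat)) : x * 2 <= v ->
  has (fun o => let: (k, j, i, b) := o in hit pts rs k j i (branch v x b)) opts ->
  x \in map (fold v) (flatten (map pts (triples rs))).
Proof.
move=> hx /hasP[[[[k j] i] b] _ /pts_hit h].
by rewrite -(fold_branch b hx); apply: map_f.
Qed.

(** The default colour [~~ c] makes the test fail beyond the end of the colour list, so that success
    also yields [j < size r.2]. *)
Lemma diffs_cover c v rs x (opts : seq (nat * nat * nat * nat)) : x * 2 <= v ->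
  has (fun o => let: (k, j, i, b) := o in
    let d := nth (~~ c) (nth row0 rs k).2 j in
    [&& if c then d else ~~ d & hit diffs rs k j i (branch v x b)]) opts ->
  (x, c) \in coloured_diffs v rs.
Proof.
move=> hx /hasP[[[[k j] i] b] _ /andP[hc /and4P[hk hi hj /eqP e]]].
set r := nth row0 rs k in hc hi e.
apply/flattenP; exists (zip (map (fold v) (diffs (term r i).1)) (term r i).2).
  apply: (map_f (fun T : triple * seq bool => zip (map (fold v) (diffs T.1)) T.2)).
  exact: term_mem.
have e2 : (term r i).2 = r.2 by rewrite /term; case: (r) => [[[[[? ?] ?] [[? ?] ?]] ?] ?].
have hj2 : j < size r.2.
  by case: (ltnP j (size r.2)) => // h; move: hc; rewrite nth_default //; case: (c).
have -> : (x, c) = nth (0, ~~ c) (zip (map (fold v) (diffs (term r i).1)) (term r i).2) j.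
  rewrite nth_zip_cond ifT; last by rewrite size_zip e2 leq_min hj2 andbT; exact: hj.
  rewrite (nth_map 0%R) // e e2 fold_branch //.
  by move: hc; case: (c) => /=; case: (nth _ _ _).
by rewrite mem_nth // size_zip e2 leq_min hj2 andbT; exact: hj.
Qed.

(** * The tables, for [t = 2 * m] and [t = 2 * m + 1] *)

(** In all four tables a pair [(a, b)] stands for [a * m + b]. A run with steps (-1, 1, 2) has
    differences moving by 2, 3 and 1, of which only the one moving by 3 is coloured [false]; a run
    with steps (1, -2, 4) has differences moving by 3, 3 and 6, all coloured [false]. The single
    triples fill the gaps. *)
Definition outer_even (m : nat) : seq row := [::
  run m (3, 2) (3, 4) (0, 4) (-1) 1 2 (m - 3) [:: true; false; true];
  run m (6, -1) (4, 6) (0, 7) (-1) 1 2 (m - 5) [:: true; false; true];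
  single m (0, 1) (2, -3) (5, 4) [:: true; true; false];
  single m (0, 2) (4, 2) (4, 3) [:: true; true; true];
  single m (0, 3) (3, 3) (6, 0) [:: false; false; false];
  single m (0, 5) (2, 0) (5, 2) [:: true; true; true];
  single m (2, -2) (2, 5) (5, 1) [:: false; true; false];
  single m (2, -1) (2, 2) (5, 3) [:: true; true; true];
  single m (2, 1) (2, 4) (4, 4) [:: false; true; true];
  single m (2, 3) (4, 1) (4, 5) [:: true; true; false]]%Z.

Definition inner_even (m : nat) : seq row := [::
  run m (4, 2) (-5, -6) (-2, 11) 1 (-2) 4 (m - 4) [:: false; false; false];
  run m (3, -3) (-4, 4) (0, 6) (-1) 1 2 (m - 5) [:: true; false; true];
  single m (0, 2) (2, -1) (5, 0) [:: true; true; false];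
  single m (0, 4) (3, -2) (-3, 0) [:: false; false; false];
  single m (2, -7) (5, -2) (5, 4) [:: false; false; false];
  single m (2, -5) (-4, 1) (5, 3) [:: false; false; false];
  single m (2, -4) (2, -2) (-5, 1) [:: false; true; true];
  single m (2, -3) (2, 2) (-4, 2) [:: false; false; false];
  single m (2, 0) (-3, -1) (4, 1) [:: true; true; true];
  single m (2, 1) (-3, 1) (4, 0) [:: true; true; true];
  single m (4, -3) (-5, -1) (-5, -2) [:: false; false; false]]%Z.

Definition outer_odd (m : nat) : seq row := [::
  run m (3, 0) (3, 4) (0, 5) (-1) 1 2 (m - 3) [:: true; false; true];
  run m (6, 2) (4, 3) (0, 4) (-1) 1 2 (m - 4) [:: true; false; true];
  single m (0, 1) (5, 0) (5, 5) [:: true; true; true];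
  single m (0, 2) (2, 2) (5, 3) [:: true; true; true];
  single m (0, 3) (3, 3) (5, 1) [:: true; true; true];
  single m (2, -4) (5, -1) (5, 6) [:: true; false; true];
  single m (2, -2) (2, 3) (5, 2) [:: false; false; false];
  single m (2, -1) (2, 1) (5, 4) [:: true; false; false];
  single m (2, 0) (4, 1) (4, 2) [:: true; true; true];
  single m (3, 1) (3, 2) (6, 3) [:: false; true; false]]%Z.

Definition inner_odd (m : nat) : seq row := [::
  run m (4, 4) (-5, -10) (-2, 13) 1 (-2) 4 (m - 6) [:: false; false; false];
  run m (3, 2) (-4, 1) (0, 2) (-1) 1 2 (m - 3) [:: true; false; true];
  single m (2, -11) (5, -2) (5, 9) [:: false; false; false];
  single m (2, -9) (-4, -3) (5, 8) [:: false; false; false];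
  single m (2, -7) (5, 1) (5, 7) [:: false; false; false];
  single m (2, -5) (2, 4) (5, 6) [:: false; false; false];
  single m (2, -4) (2, -1) (-4, -1) [:: true; false; false];
  single m (2, -3) (2, 5) (5, 3) [:: false; false; false];
  single m (2, -2) (-2, -2) (5, 5) [:: true; false; true];
  single m (2, 0) (-5, 0) (-5, -4) [:: true; true; false];
  single m (2, 1) (-4, 0) (-4, -2) [:: false; false; false];
  single m (2, 3) (-5, 1) (-5, -2) [:: true; true; false]]%Z.

(** * Coverage of [[1, 3t]] by points and coloured differences *)

Lemma residue6 n : exists q, n = 6 * q \/ n = 6 * q + 1 \/ n = 6 * q + 2 \/
  n = 6 * q + 3 \/ n = 6 * q + 4 \/ n = 6 * q + 5.
Proof. by exists (n %/ 6); lia. Qed.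

(* An option (k, j, i, b) says that the j-th point (or difference) of the i-th
   triple of row k is [branch v x b]; [zone x c opts] proves that one of the
   options is correct for all x <= c and leaves the case c < x.  In [zone6] the
   residue of n modulo 6 decides between the options. *)
Ltac cover_tac opts :=
  first [refine (@pts_cover _ _ opts _)
        |refine (@fold_cover _ _ _ opts _ _); first lia
        |refine (@diffs_cover _ _ _ _ opts _ _); first lia];
  cbv beta iota zeta delta
  [has hit branch nth size cat map fst snd outer_even inner_even outer_odd inner_odd
   run single lin term pts diffs row0 negb]; lia.
Ltac cover_each opts :=
  lazymatch opts with
  | ?o :: ?opts' => first [cover_tac constr:([:: o]) | cover_each opts']
  end.
Tactic Notation "cover" constr(opts) := cover_tac opts.
Tactic Notation "cover6" constr(n) constr(opts) :=
  case: (residue6 n) => ? [?|[?|[?|[?|[?|?]]]]]; cover_each opts.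
Tactic Notation "zone" constr(x) constr(c) constr(opts) :=
  case: (leqP x c) => [?|?]; [cover opts|].
Tactic Notation "zone6" constr(n) constr(x) constr(c) constr(opts) :=
  case: (leqP x c) => [?|?]; [cover6 n opts|].

(** The third points of the two runs supply the two parities below about [2 * m]; their first and
    second points fill four intervals of length about [m] above. *)
Lemma outer_pts_even m x : 6 <= m -> 0 < x <= 6 * m ->
  Posz x \in flatten (map pts (triples (outer_even m))).
Proof.
move=> hm /andP[x0 xt].
zone x (3) [:: (2, 0, 0, 0); (3, 0, 0, 0); (4, 0, 0, 0)].
zone x (2 * m - 4) [:: (0, 2, (x - 4) %/ 2, 0); (5, 0, 0, 0); (1, 2, (x - 7) %/ 2, 0)].
zone x (2 * m - 1) [:: (2, 1, 0, 0); (6, 0, 0, 0); (7, 0, 0, 0)].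
zone x (2 * m + 2) [:: (5, 1, 0, 0); (8, 0, 0, 0); (7, 1, 0, 0)].
zone x (2 * m + 5) [:: (9, 0, 0, 0); (8, 1, 0, 0); (6, 1, 0, 0)].
zone x (4 * m) [:: (0, 0, 3 * m + 2 - x, 0); (4, 1, 0, 0); (0, 1, x - (3 * m + 4), 0)].
zone x (4 * m + 3) [:: (9, 1, 0, 0); (3, 1, 0, 0); (3, 2, 0, 0)].
zone x (5 * m) [:: (8, 2, 0, 0); (9, 2, 0, 0); (1, 1, x - (4 * m + 6), 0)].
zone x (5 * m + 3) [:: (6, 2, 0, 0); (5, 2, 0, 0); (7, 2, 0, 0)].
by cover [:: (2, 2, 0, 0); (1, 0, 6 * m - (x + 1), 0); (4, 2, 0, 0)].
Qed.

(** The third points of row 0 run by fours from about [-2 * m] to [2 * m], and the two signs give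
    the two odd classes modulo 4. Its second points run by twos past [-6 * m]; there folding
    reflects them, into the other parity because [v] is odd. *)
Lemma inner_pts_even m x : 7 <= m -> 0 < x <= 6 * m ->
  x \in map (fold (6 * (2 * m) + 1)) (flatten (map pts (triples (inner_even m)))).
Proof.
move=> hm /andP[x0 xt].
zone x (5) [:: (0, 2, (2 * m - (x + 11)) %/ 4, 1); (0, 2, (x + 2 * m - 11) %/ 4, 0);
    (2, 0, 0, 0); (3, 0, 0, 0)].
zone x (2 * m - 6) [:: (1, 2, (x - 6) %/ 2, 0); (0, 2, (2 * m - (x + 11)) %/ 4, 1);
    (0, 2, (x + 2 * m - 11) %/ 4, 0); (4, 0, 0, 0)].
zone x (2 * m - 3) [:: (5, 0, 0, 0); (6, 0, 0, 0); (7, 0, 0, 0)].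
zone x (2 * m) [:: (6, 1, 0, 0); (2, 1, 0, 0); (8, 0, 0, 0)].
zone x (3 * m - 3) [:: (9, 0, 0, 0); (7, 1, 0, 0); (1, 0, 3 * m - (x + 3), 0)].
zone x (3 * m) [:: (3, 1, 0, 0); (9, 1, 0, 1); (3, 2, 0, 1)].
zone x (4 * m - 3) [:: (8, 1, 0, 1); (1, 1, 4 * m - (x + 4), 1); (10, 0, 0, 0)].
zone x (4 * m) [:: (7, 2, 0, 1); (5, 1, 0, 1); (9, 2, 0, 0)].
zone x (5 * m - 2) [:: (8, 2, 0, 0); (0, 0, x - (4 * m + 2), 0); (4, 1, 0, 0)].
zone x (5 * m + 1) [:: (6, 2, 0, 1); (2, 2, 0, 0); (10, 1, 0, 1)].
zone x (5 * m + 4) [:: (10, 2, 0, 1); (5, 2, 0, 0); (4, 2, 0, 0)].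
by cover [:: (0, 1, (x - (5 * m + 6)) %/ 2, 1); (0, 1, (7 * m - (x + 5)) %/ 2, 3)].
Qed.

(** Two differences moving by 2 share the range below about [2 * m] by parity, those moving by 1
    fill up to about [5 * m], and one moving by 2 fills the rest twice over, once directly and once
    reflected into the other parity. *)
Lemma diffs_true_even m x : 6 <= m -> 0 < x <= 6 * m ->
  (x, true) \in coloured_diffs (6 * (2 * m) + 1) (outer_even m ++ inner_even m).
Proof.
move=> hm /andP[x0 xt].
zone x (4) [:: (3, 2, 0, 1); (0, 0, (x - 2) %/ 2, 1); (7, 0, 0, 1)].
zone x (2 * m - 5) [:: (1, 0, (2 * m - (x + 7)) %/ 2, 0); (0, 0, (x - 2) %/ 2, 1);
    (5, 0, 0, 1)].
zone x (2 * m - 2) [:: (2, 0, 0, 1); (12, 0, 0, 1); (9, 0, 0, 1)].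
zone x (2 * m + 1) [:: (19, 1, 0, 1); (8, 2, 0, 1); (18, 1, 0, 1)].
zone x (3 * m) [:: (9, 1, 0, 1); (8, 1, 0, 1); (0, 2, 3 * m - x, 0)].
zone x (3 * m + 3) [:: (7, 2, 0, 1); (5, 2, 0, 1); (6, 1, 0, 1)].
zone x (4 * m) [:: (7, 1, 0, 1); (1, 2, 4 * m - (x + 1), 0); (3, 0, 0, 1)].
zone x (5 * m - 3) [:: (3, 1, 0, 1); (11, 2, x - (4 * m + 2), 1); (5, 1, 0, 1)].
zone x (5 * m) [:: (12, 1, 0, 1); (18, 2, 0, 3); (19, 0, 0, 0)].
zone x (5 * m + 3) [:: (18, 0, 0, 0); (19, 2, 0, 3); (2, 1, 0, 1)].
by cover [:: (16, 2, 0, 2); (11, 0, (x - (5 * m + 8)) %/ 2, 2);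
    (11, 0, (7 * m - (x + 7)) %/ 2, 0); (16, 1, 0, 2)].
Qed.

(** Below about [3 * m], three differences moving by 3 take one class modulo 3 each. Above, two such
    differences take the classes 0 and 1; class 2 comes from the difference moving by 6, whose
    direct and reflected parts have opposite parities. *)
Lemma diffs_false_even m x : 7 <= m -> 0 < x <= 6 * m ->
  (x, false) \in coloured_diffs (6 * (2 * m) + 1) (outer_even m ++ inner_even m).
Proof.
move=> hm /andP[x0 xt].
zone x (3) [:: (20, 2, 0, 0); (16, 0, 0, 1); (8, 0, 0, 1)].
zone x (6) [:: (9, 2, 0, 1); (17, 0, 0, 1); (14, 2, 0, 1)].
zone x (9) [:: (6, 0, 0, 1); (10, 0, (3 * m - (x + 7)) %/ 3, 2);
    (11, 1, (3 * m - (x + 9)) %/ 3, 0)].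
zone x (3 * m - 7) [:: (0, 1, (3 * m - (x + 2)) %/ 3, 0);
    (10, 0, (3 * m - (x + 7)) %/ 3, 2); (11, 1, (3 * m - (x + 9)) %/ 3, 0)].
zone x (3 * m - 4) [:: (13, 0, 0, 1); (0, 1, (3 * m - (x + 2)) %/ 3, 0); (6, 2, 0, 1)].
zone x (3 * m - 1) [:: (4, 2, 0, 1); (0, 1, (3 * m - (x + 2)) %/ 3, 0); (15, 2, 0, 3)].
zone x (3 * m + 2) [:: (4, 0, 0, 1); (12, 2, 0, 1); (20, 1, 0, 2)].
zone x (3 * m + 5) [:: (20, 0, 0, 2); (13, 1, 0, 0); (14, 0, 0, 1)].
zone x (3 * m + 9) [:: (10, 1, (6 * m - (x + 9)) %/ 3, 0); (2, 2, 0, 1); (15, 1, 0, 1)].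
zone x (3 * m + 13) [:: (1, 1, (6 * m - (x + 8)) %/ 3, 0); (14, 1, 0, 1);
    (10, 1, (6 * m - (x + 9)) %/ 3, 0)].
(* The residue of [x + 3 * m + 1] is 0 on the direct part of the progression by sixes and 3 on its
   reflected part. *)
zone6 (x + 3 * m + 1) x (6 * m - 7) [:: (10, 2, (x - (3 * m + 17)) %/ 6, 1);
    (10, 2, (9 * m - (x + 16)) %/ 6, 3); (10, 1, (6 * m - (x + 9)) %/ 3, 0);
    (1, 1, (6 * m - (x + 8)) %/ 3, 0)].
zone6 (x + 3 * m + 1) x (6 * m - 4) [:: (15, 0, 0, 0); (17, 1, 0, 0);
    (10, 2, (x - (3 * m + 17)) %/ 6, 1); (10, 2, (9 * m - (x + 16)) %/ 6, 3)].
zone6 (x + 3 * m + 1) x (6 * m - 1) [:: (4, 1, 0, 1); (13, 2, 0, 0);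
    (10, 2, (x - (3 * m + 17)) %/ 6, 1); (10, 2, (9 * m - (x + 16)) %/ 6, 3)].
by cover [:: (17, 2, 0, 0)].
Qed.

Lemma outer_pts_odd m x : 6 <= m -> 0 < x <= 6 * m + 3 ->
  Posz x \in flatten (map pts (triples (outer_odd m))).
Proof.
move=> hm /andP[x0 xt].
zone x (3) [:: (2, 0, 0, 0); (3, 0, 0, 0); (4, 0, 0, 0)].
zone x (2 * m - 3) [:: (1, 2, (x - 4) %/ 2, 0); (0, 2, (x - 5) %/ 2, 0); (5, 0, 0, 0)].
zone x (2 * m) [:: (6, 0, 0, 0); (7, 0, 0, 0); (8, 0, 0, 0)].
zone x (2 * m + 3) [:: (7, 1, 0, 0); (3, 1, 0, 0); (6, 1, 0, 0)].
zone x (3 * m + 2) [:: (0, 0, 3 * m - x, 0); (9, 0, 0, 0); (9, 1, 0, 0)].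
zone x (4 * m + 1) [:: (4, 1, 0, 0); (0, 1, x - (3 * m + 4), 0); (8, 1, 0, 0)].
zone x (5 * m - 1) [:: (8, 2, 0, 0); (1, 1, x - (4 * m + 3), 0); (5, 1, 0, 0)].
zone x (5 * m + 2) [:: (2, 1, 0, 0); (4, 2, 0, 0); (6, 2, 0, 0)].
zone x (5 * m + 5) [:: (3, 2, 0, 0); (7, 2, 0, 0); (2, 2, 0, 0)].
by cover [:: (5, 2, 0, 0); (1, 0, 6 * m + 2 - x, 0); (9, 2, 0, 0)].
Qed.

Lemma inner_pts_odd m x : 6 <= m -> 0 < x <= 6 * m + 3 ->
  x \in map (fold (6 * (2 * m).+1 + 1)) (flatten (map pts (triples (inner_odd m)))).
Proof.
move=> hm /andP[x0 xt].
zone x (2 * m - 10) [:: (0, 2, (2 * m - (x + 13)) %/ 4, 1);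
    (0, 2, (x + 2 * m - 13) %/ 4, 0); (1, 2, (x - 2) %/ 2, 0); (2, 0, 0, 0)].
zone x (2 * m - 6) [:: (3, 0, 0, 0); (1, 2, (x - 2) %/ 2, 0); (4, 0, 0, 0)].
zone x (2 * m - 3) [:: (5, 0, 0, 0); (6, 0, 0, 0); (7, 0, 0, 0)].
zone x (2 * m) [:: (8, 0, 0, 0); (6, 1, 0, 0); (9, 0, 0, 0)].
zone x (2 * m + 3) [:: (10, 0, 0, 0); (8, 1, 0, 1); (11, 0, 0, 0)].
zone x (3 * m + 2) [:: (5, 1, 0, 0); (7, 1, 0, 0); (1, 0, 3 * m + 2 - x, 0)].
zone x (4 * m + 1) [:: (1, 1, 4 * m - (x + 1), 1); (10, 1, 0, 1); (6, 2, 0, 1)].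
zone x (5 * m - 3) [:: (10, 2, 0, 1); (3, 1, 0, 1); (0, 0, x - (4 * m + 4), 0)].
zone x (5 * m) [:: (2, 1, 0, 0); (11, 1, 0, 1); (9, 1, 0, 1)].
zone x (5 * m + 3) [:: (4, 1, 0, 0); (11, 2, 0, 1); (7, 2, 0, 0)].
zone x (5 * m + 6) [:: (9, 2, 0, 1); (8, 2, 0, 0); (5, 2, 0, 0)].
zone x (5 * m + 9) [:: (4, 2, 0, 0); (3, 2, 0, 0); (2, 2, 0, 0)].
by cover [:: (0, 1, (x - (5 * m + 10)) %/ 2, 1); (0, 1, (7 * m - (x + 3)) %/ 2, 3)].
Qed.

Lemma diffs_true_odd m x : 6 <= m -> 0 < x <= 6 * m + 3 ->
  (x, true) \in coloured_diffs (6 * (2 * m).+1 + 1) (outer_odd m ++ inner_odd m).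
Proof.
move=> hm /andP[x0 xt].
zone x (3) [:: (8, 2, 0, 1); (7, 0, 0, 1); (16, 0, 0, 1)].
zone x (8) [:: (0, 0, (x - 4) %/ 2, 1); (2, 2, 0, 1); (5, 2, 0, 1)].
zone x (2 * m - 1) [:: (1, 0, (2 * m - (x + 1)) %/ 2, 0); (0, 0, (x - 4) %/ 2, 1);
    (4, 2, 0, 1)].
zone x (2 * m + 2) [:: (3, 0, 0, 1); (8, 0, 0, 1); (8, 1, 0, 1)].
zone x (3 * m + 1) [:: (0, 2, 3 * m - (x + 1), 0); (4, 0, 0, 1); (3, 2, 0, 1)].
zone x (4 * m - 1) [:: (9, 1, 0, 1); (5, 0, 0, 1); (1, 2, 4 * m - (x + 1), 0)].
zone x (5 * m - 2) [:: (18, 0, 0, 0); (11, 2, x - (4 * m + 1), 1); (4, 1, 0, 1)].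
zone x (5 * m + 1) [:: (2, 0, 0, 1); (18, 2, 0, 3); (3, 1, 0, 1)].
zone x (5 * m + 4) [:: (21, 1, 0, 2); (19, 1, 0, 2); (2, 1, 0, 1)].
by cover [:: (21, 0, 0, 2); (11, 0, (x - (5 * m + 6)) %/ 2, 2);
    (11, 0, (7 * m + 1 - x) %/ 2, 0); (19, 0, 0, 2)].
Qed.

Lemma diffs_false_odd m x : 10 <= m -> 0 < x <= 6 * m + 3 ->
  (x, false) \in coloured_diffs (6 * (2 * m).+1 + 1) (outer_odd m ++ inner_odd m).
Proof.
move=> hm /andP[x0 xt].
zone x (3) [:: (9, 0, 0, 1); (20, 2, 0, 0); (21, 2, 0, 0)].
zone x (6) [:: (19, 2, 0, 0); (6, 0, 0, 1); (14, 2, 0, 1)].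
zone x (10) [:: (0, 1, (3 * m - (x + 5)) %/ 3, 0); (17, 0, 0, 1); (15, 0, 0, 1)].
zone x (13) [:: (12, 2, 0, 1); (11, 1, (3 * m - x) %/ 3, 0);
    (0, 1, (3 * m - (x + 5)) %/ 3, 0)].
zone x (3 * m - 5) [:: (10, 0, (3 * m - (x + 7)) %/ 3, 2); (11, 1, (3 * m - x) %/ 3, 0);
    (0, 1, (3 * m - (x + 5)) %/ 3, 0)].
zone x (3 * m - 2) [:: (13, 2, 0, 3); (11, 1, (3 * m - x) %/ 3, 0); (17, 2, 0, 1)].
zone x (3 * m + 1) [:: (6, 2, 0, 1); (11, 1, (3 * m - x) %/ 3, 0); (9, 2, 0, 1)].
zone x (3 * m + 4) [:: (15, 2, 0, 1); (7, 2, 0, 1); (6, 1, 0, 1)].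
zone x (3 * m + 7) [:: (7, 1, 0, 1); (17, 1, 0, 1); (18, 1, 0, 1)].
zone x (3 * m + 10) [:: (14, 0, 0, 1); (12, 0, 0, 1); (5, 1, 0, 1)].
zone x (3 * m + 13) [:: (15, 1, 0, 1); (10, 1, (6 * m - (x + 9)) %/ 3, 0);
    (1, 1, (6 * m - (x + 2)) %/ 3, 0)].
zone x (3 * m + 16) [:: (14, 1, 0, 1); (10, 1, (6 * m - (x + 9)) %/ 3, 0);
    (1, 1, (6 * m - (x + 2)) %/ 3, 0)].
zone x (3 * m + 19) [:: (13, 1, 0, 1); (10, 1, (6 * m - (x + 9)) %/ 3, 0);
    (1, 1, (6 * m - (x + 2)) %/ 3, 0)].
zone x (3 * m + 22) [:: (12, 1, 0, 1); (10, 1, (6 * m - (x + 9)) %/ 3, 0);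
    (1, 1, (6 * m - (x + 2)) %/ 3, 0)].
zone6 (x + 3 * m + 1) x (6 * m - 7) [:: (10, 2, (x - (3 * m + 23)) %/ 6, 1);
    (10, 2, (9 * m - (x + 16)) %/ 6, 3); (10, 1, (6 * m - (x + 9)) %/ 3, 0);
    (1, 1, (6 * m - (x + 2)) %/ 3, 0)].
zone6 (x + 3 * m + 1) x (6 * m - 4) [:: (13, 0, 0, 0); (1, 1, (6 * m - (x + 2)) %/ 3, 0);
    (10, 2, (x - (3 * m + 23)) %/ 6, 1); (10, 2, (9 * m - (x + 16)) %/ 6, 3)].
zone6 (x + 3 * m + 1) x (6 * m - 1) [:: (16, 1, 0, 0); (1, 1, (6 * m - (x + 2)) %/ 3, 0);
    (10, 2, (x - (3 * m + 23)) %/ 6, 1); (10, 2, (9 * m - (x + 16)) %/ 6, 3)].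
zone6 (x + 3 * m + 1) x (6 * m + 2) [:: (16, 2, 0, 0); (20, 0, 0, 0);
    (10, 2, (x - (3 * m + 23)) %/ 6, 1); (10, 2, (9 * m - (x + 16)) %/ 6, 3)].
by cover [:: (20, 1, 0, 0)].
Qed.

(** * Assembly of the families, and the small cases *)

Definition small_family (t : nat) : seq triple * seq triple :=
  match t with
  | 3 => ([:: (1, 7, 9); (2, 5, 6); (3, 4, 8)]%Z,
         [:: (1, -6, -8); (2, -3, -9); (4, -5, 7)]%Z)
  | 4 => ([:: (1, 7, 10); (2, 3, 12); (4, 6, 11); (5, 8, 9)]%Z,
         [:: (1, -4, 9); (2, -6, -12); (3, 10, -11); (5, 7, -8)]%Z)
  | 5 => ([:: (1, 4, 13); (2, 9, 12); (3, 7, 15); (5, 10, 11); (6, 8, 14)]%Z,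
         [:: (1, -9, -14); (2, 4, 13); (3, -11, -15); (5, -8, 12); (6, 7, -10)]%Z)
  | 6 => ([:: (1, 11, 14); (2, 10, 17); (3, 13, 18); (4, 8, 9); (5, 7, 16); (6, 12, 15)]%Z,
         [:: (1, -13, 17); (2, 6, -12); (3, 11, -14); (4, 10, -15); (5, 16, 18);
             (7, 8, -9)]%Z)
  | 7 => ([:: (1, 6, 17); (2, 12, 16); (3, 5, 18); (4, 13, 19); (7, 10, 15); (8, 9, 20);
             (11, 14, 21)]%Z,
         [:: (1, -5, 13); (2, 4, -20); (3, -6, 17); (7, -18, -19); (8, -14, 21);
             (9, -10, 16); (11, -12, 15)]%Z)
  | 8 => ([:: (1, 6, 19); (2, 16, 17); (3, 5, 22); (4, 12, 24); (7, 9, 18); (8, 15, 21);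
             (10, 11, 14); (13, 20, 23)]%Z,
         [:: (1, -16, 23); (2, 6, -22); (3, -19, 21); (4, -8, 20); (5, -9, -14);
             (7, 15, -18); (10, -13, -24); (11, -12, 17)]%Z)
  | 9 => ([:: (1, 19, 24); (2, 16, 18); (3, 11, 21); (4, 15, 26); (5, 7, 13); (6, 12, 27);
             (8, 17, 20); (9, 14, 23); (10, 22, 25)]%Z,
         [:: (1, -16, -23); (2, 3, -27); (4, 11, -25); (5, 6, -22); (7, -18, 24);
             (8, -12, 21); (9, 13, -26); (10, -14, 20); (15, -17, 19)]%Z)
  | 11 => ([:: (1, 4, 30); (2, 27, 32); (3, 15, 28); (5, 26, 33); (6, 16, 24); (7, 10, 29);
             (8, 9, 25); (11, 17, 31); (12, 21, 23); (13, 20, 22); (14, 18, 19)]%Z,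
         [:: (1, 11, -33); (2, 28, -31); (3, -12, 25); (4, -16, -32); (5, -10, 17);
             (6, -18, 30); (7, 20, -29); (8, 22, -24); (9, 13, -19);
             (14, -15, -26); (21, -23, 27)]%Z)
  | _ => ([::], [::])
  end.

(** Equal lengths leave no room for repetitions, so coverage suffices. *)
Lemma perm_eq_of_subset (T : eqType) (s s' : seq T) :
  uniq s' -> {subset s' <= s} -> size s = size s' -> perm_eq s s'.
Proof.
move=> u sub sz; have [_ eqm] := uniq_min_size u sub (eq_leq sz).
by apply: uniq_perm => //; apply: leq_size_uniq u sub (eq_leq sz).
Qed.

Lemma size_flatten_map (S T : Type) (f : S -> seq T) n (s : seq S) :
  (forall x, size (f x) = n) -> size (flatten (map f s)) = n * size s.
Proof. by move=> h; elim: s => [|x s IH] /=; rewrite ?muln0 // size_cat IH h mulnS. Qed.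

Lemma size_triples rs : size (triples rs) = sumn [seq r.1.2 | r <- rs].
Proof.
rewrite /triples size_map; elim: rs => //= r rs IH.
by rewrite /terms /= size_cat size_map size_iota; congr (_ + _).
Qed.

Lemma coloured_diffs_fst v rs : all (fun r : row => size r.2 == 3) rs ->
  map fst (coloured_diffs v rs) = map (fold v) (flatten (map diffs (triples rs))).
Proof.
move=> h3.
have : all (fun T : triple * seq bool => size T.2 == 3) (terms rs).
  apply/allP => T /flattenP[_ /mapP[r hr ->] /mapP[i _ ->]].
  by move: (allP h3 _ hr) => {hr h3}; case: r => [[[[[? ?] ?] [[? ?] ?]] ?] ?].
rewrite /coloured_diffs /triples; elim: (terms rs) => //= T L IH /andP[hT hL].
by rewrite map_cat IH // [X in X ++ _ = _]unzip1_zip ?(eqP hT) // map_cat.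
Qed.

(** The colours make the doubled interval a duplicate-free target, so coverage and counting apply to
    the [6 * t] differences; the colours are erased afterwards. *)
Lemma family_of_cover t (O I : seq row) :
  let v := 6 * t + 1 in
  all (fun r : row => size r.2 == 3) (O ++ I) ->
  size (triples O) = t -> size (triples I) = t ->
  (forall x, 0 < x <= 3 * t -> Posz x \in flatten (map pts (triples O))) ->
  (forall x, 0 < x <= 3 * t -> x \in map (fold v) (flatten (map pts (triples I)))) ->
  (forall x, 0 < x <= 3 * t -> (x, true) \in coloured_diffs v (O ++ I)) ->
  (forall x, 0 < x <= 3 * t -> (x, false) \in coloured_diffs v (O ++ I)) ->
  twofold_family t (triples O) (triples I).
Proof.
move=> v h3 sO sI hO hI hT hF; apply/and3P; split.
- apply: perm_eq_of_subset; first by rewrite map_inj_uniq ?iota_uniq // => ? ? [].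
    by move=> _ /mapP[x hx ->]; apply: hO; rewrite mem_iota in hx; lia.
  by rewrite (size_flatten_map (n := 3)) // sO size_map size_iota.
- apply: perm_eq_of_subset; first by rewrite iota_uniq.
    by move=> x; rewrite mem_iota => hx; apply: hI; lia.
  by rewrite size_map (size_flatten_map (n := 3)) // sI size_iota.
have OI : triples O ++ triples I = triples (O ++ I).
  by rewrite /triples /terms map_cat flatten_cat map_cat.
rewrite OI -(coloured_diffs_fst _ h3).
have -> : iota 1 (3 * t) ++ iota 1 (3 * t) =
    map fst (map (pair^~ true) (iota 1 (3 * t)) ++ map (pair^~ false) (iota 1 (3 * t))).
  by rewrite map_cat -!map_comp /comp /= map_id.
apply: perm_map; apply: perm_eq_of_subset.
- rewrite cat_uniq !map_inj_uniq ?iota_uniq /=; try by move=> ? ? [].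
  by rewrite andbT; apply/hasPn => _ /mapP[x _ ->]; apply/mapP => -[].
- move=> p; rewrite mem_cat => /orP[] /mapP[x]; rewrite mem_iota => hx ->.
    by apply: hT; lia.
  by apply: hF; lia.
rewrite -(size_map fst) coloured_diffs_fst // size_map (size_flatten_map (n := 3)) //.
by rewrite -OI size_cat sO sI size_cat !size_map size_iota; lia.
Qed.

Lemma even_family m : 7 <= m ->
  twofold_family (2 * m) (triples (outer_even m)) (triples (inner_even m)).
Proof.
move=> hm; apply: family_of_cover => //; try by rewrite size_triples /=; lia.
- by move=> x hx; apply: outer_pts_even; lia.
- by move=> x hx; apply: inner_pts_even; lia.
- by move=> x hx; apply: diffs_true_even; lia.
by move=> x hx; apply: diffs_false_even; lia.
Qed.

Lemma odd_family m : 10 <= m ->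
  twofold_family (2 * m).+1 (triples (outer_odd m)) (triples (inner_odd m)).
Proof.
move=> hm; apply: family_of_cover => //; try by rewrite size_triples /=; lia.
- by move=> x hx; apply: outer_pts_odd; lia.
- by move=> x hx; apply: inner_pts_odd; lia.
- by move=> x hx; apply: diffs_true_odd; lia.
by move=> x hx; apply: diffs_false_odd; lia.
Qed.

Lemma small_families : all (fun t => twofold_family t (small_family t).1 (small_family t).2)
  [:: 3; 4; 5; 6; 7; 8; 9; 11].
Proof. by vm_compute. Qed.

(** The tables already work for these [m], below the bounds assumed by the covering lemmas; likewise
    in the odd case. *)
Lemma small_even_families :
  all (fun m => twofold_family (2 * m) (triples (outer_even m)) (triples (inner_even m))) [:: 5; 6].
Proof. by vm_compute. Qed.

Lemma small_odd_families :
  all (fun m => twofold_family (2 * m).+1 (triples (outer_odd m)) (triples (inner_odd m)))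
    [:: 6; 7; 8; 9].
Proof. by vm_compute. Qed.

(** The tables serve even [t] from 10 on and odd [t] from 13 on; the other eight values are
    explicit. *)
Lemma twofold_family_exists t : 3 <= t -> exists O I, twofold_family t O I.
Proof.
move=> t3; have [ts|ts] := boolP (t \in [:: 3; 4; 5; 6; 7; 8; 9; 11]).
  by exists (small_family t).1, (small_family t).2; apply: (allP small_families).
have [m [e|e]] : exists m, t = 2 * m \/ t = (2 * m).+1 by exists (t %/ 2); lia.
- exists (triples (outer_even m)), (triples (inner_even m)); rewrite e.
  have [h|h] := leqP 7 m; first exact: even_family.
  by apply: (allP small_even_families); move: ts; rewrite e !inE; lia.
exists (triples (outer_odd m)), (triples (inner_odd m)); rewrite e.
have [h|h] := leqP 10 m; first exact: odd_family.
by apply: (allP small_odd_families); move: ts; rewrite e !inE; lia.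
Qed.

Theorem theorem4p5 (v : nat) :
  v %% 6 = 1 -> 19 <= v ->
  (exists (X : {set 'I_((3 * v + 1) %/ 2)}) (B : seq {set 'I_((3 * v + 1) %/ 2)})
          (phi : 'I_(size B) -> 'I_((3 * v + 1) %/ 2)),
      is_BIBD X B v 3 2 /\ strong_nesting phi) /\
  (forall (T : finType) (X : {set T}) (B : seq {set T}) (phi : 'I_(size B) -> T),
      is_BIBD X B v 3 2 -> strong_nesting phi -> (3 * v + 1) %/ 2 <= #|T|).
Proof.
move=> v1 v19; split; last first.
  by move=> T X B phi bibd nest; apply: (nesting_lower_bound bibd nest v1); lia.
have e : v = 6 * (v %/ 6) + 1 by lia.
have [O [I fam]] := @twofold_family_exists (v %/ 6) ltac:(lia).
have w : (3 * v + 1) %/ 2 = 9 * (v %/ 6) + 2 by lia.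
by have := nested_design (t := v %/ 6) ltac:(lia) fam w; rewrite -e.
Qed.
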